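(* Let $\Theta_1$ and $\Theta_2$ be two distinct commuting involutive antimorphisms on $\mathcal{A}^*$. If $\mathbf{u}$ is an infinite word with language closed under $\Theta_1$ and $\Theta_2$, then for all $n\ge 1$, $$\Delta\mathcal{C}(n)+4 \ge \mathcal{P}_{\Theta_1}(n)+\mathcal{P}_{\Theta_2}(n)-\mathcal{P}_{\Theta_1,\Theta_2}(n)+\mathcal{P}_{\Theta_1}(n+1)+\mathcal{P}_{\Theta_2}(n+1)-\mathcal{P}_{\Theta_1,\Theta_2}(n+1),$$ where $\mathcal{P}_{\Theta_1,\Theta_2}(k)=\#\{w\in\mathcal{L}_k(\mathbf{u}) \mid w=\Theta_1(w)=\Theta_2(w)\}$.
   Context: An antimorphism on $\mathcal{A}^*$ is a map $\Theta$ with $\Theta(vw)=\Theta(w)\Theta(v)$; involutive means $\Theta^2=\mathrm{Id}$. $\mathcal{L}_n(\mathbf{u})$ is the set of factors of $\mathbf{u}$ of length $n$ and $\mathcal{L}(\mathbf{u})$ the set of all factors; the language is closed under $\Theta$ if $\Theta(\mathcal{L}(\mathbf{u}))\subseteq\mathcal{L}(\mathbf{u})$. $\mathcal{C}(n)=\#\mathcal{L}_n(\mathbf{u})$ is the factor complexity and $\Delta\mathcal{C}(n)=\mathcal{C}(n+1)-\mathcal{C}(n)$. For an antimorphism $\Theta$, $\mathcal{P}_\Theta(n)=\#\{w\in\mathcal{L}_n(\mathbf{u}) \mid \Theta(w)=w\}$. The alphabet $\mathcal{A}$ is assumed to consist exactly of the letters occurring in $\mathbf{u}$. *)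

(* Defs.v *)
From mathcomp Require Import all_boot all_order all_algebra.
From mathcomp Require Import boolp.

Set Implicit Arguments.
Unset Strict Implicit.
Unset Printing Implicit Defensive.

Import Order.TTheory GRing.Theory Num.Theory.
Local Open Scope ring_scope.

Definition antimorphism (A : Type) (Theta : seq A -> seq A) : Prop :=
  forall v w : seq A, Theta (v ++ w) = Theta w ++ Theta v.

(* An infinite word over A is a function u : nat -> A. *)
Definition factor (A : Type) (u : nat -> A) (w : seq A) : Prop :=
  exists i : nat, w = mkseq (fun k => u (i + k)%N) (size w).

Definition closed_under (A : Type) (u : nat -> A) (Theta : seq A -> seq A) :
    Prop :=
  forall w : seq A, factor u w -> factor u (Theta w).

(* `[< P >] is the classical truth value of P, so #|factors u n| is the usual
   cardinality even though being a factor is not decidable. *)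
Definition factors (A : finType) (u : nat -> A) (n : nat) : {set n.-tuple A} :=
  [set w : n.-tuple A | `[< factor u w >]].

Definition complexity (A : finType) (u : nat -> A) (n : nat) : nat :=
  #|factors u n|.

Definition Dcomplexity (A : finType) (u : nat -> A) (n : nat) : int :=
  (complexity u n.+1)%:Z - (complexity u n)%:Z.

Definition pal_complexity (A : finType) (u : nat -> A)
    (Theta : seq A -> seq A) (n : nat) : nat :=
  #|[set w in factors u n | Theta w == w :> seq A]|.

Definition pal_complexity2 (A : finType) (u : nat -> A)
    (Theta1 Theta2 : seq A -> seq A) (n : nat) : nat :=
  #|[set w in factors u n |
      (w == Theta1 w :> seq A) && (Theta1 w == Theta2 w)]|.

(* Main.v *)
Require Import Defs.
From mathcomp Require Import all_boot all_order all_algebra.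
From mathcomp Require Import boolp zify.

Import Order.TTheory GRing.Theory Num.Theory.
Local Open Scope ring_scope.

(** Let [G] be the group of order at most 4 generated by [Theta1] and [Theta2],
    acting on the Rauzy graph whose vertices are the factors of length [n] and
    whose edges are the factors of length [n + 1].  For a factor [v] let [d v]
    be the least position at which some element of the [G]-orbit of [v] occurs;
    [d] is [G]-invariant.  Call an edge steep if [d] differs at its two ends,
    and map it to the end where [d] is larger.  An edge fixed by [Theta1] or
    [Theta2] is not steep, since its ends are exchanged.  Every vertex [v] with
    [d v > 0] is hit: move the occurrence one step to the left.  If moreover
    [v] is fixed by [Theta_i], it is hit by both [e] and [Theta_i e <> e].
    The vertices with [d v = 0] form a single orbit, where the number of
    vertices plus the number of palindromic ones is at most 4. *)

(** No letter is sent to the empty word, since [Theta] already fixes that word and is injective.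
    Hence lengths cannot decrease, and applying this twice gives equality. *)
Lemma size_antimorphism {A : Type} {Theta : seq A -> seq A} :
  antimorphism Theta -> involutive Theta ->
  forall w, size (Theta w) = size w.
Proof.
move=> anti inv.
have T0 : Theta [::] = [::].
  have := congr1 size (anti [::] [::]); rewrite size_cat /=.
  by case: (Theta [::]) => //= a s; lia.
have le_size w : (size w <= size (Theta w))%N.
  elim: w => [//|a s IHs].
  rewrite -cat1s anti !size_cat /= addnC leq_add //.
  case E: (Theta [:: a]) => [|//].
  by have := inv [:: a]; rewrite E T0.
move=> w; apply/eqP; rewrite eqn_leq le_size andbT.
by rewrite -{2}(inv w) le_size.
Qed.

(** With its companion below, this says that [Theta] reverses the edges of the Rauzy graph. *)
Lemma take_antimorphism {A : Type} {Theta : seq A -> seq A} :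
  antimorphism Theta -> involutive Theta ->
  forall n w, size w = n.+1 -> take n (Theta w) = Theta (drop 1 w).
Proof.
move=> anti inv n w sw.
rewrite -{1}(cat_take_drop 1 w) anti take_size_cat //.
by rewrite (size_antimorphism anti inv) size_drop sw subn1.
Qed.

Lemma drop_antimorphism {A : Type} {Theta : seq A -> seq A} :
  antimorphism Theta -> involutive Theta ->
  forall n w, size w = n.+1 -> drop 1 (Theta w) = Theta (take n w).
Proof.
move=> anti inv n w sw.
rewrite -{1}(cat_take_drop n w) anti drop_size_cat //.
by rewrite (size_antimorphism anti inv) size_drop sw subSnn.
Qed.

Lemma card_set_tuple_le {A : finType} {n} (Z : {set n.-tuple A})
    (s : seq (seq A)) :
  {in Z, forall v, tval v \in s} -> (#|Z| <= size s)%N.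
Proof.
move=> sub; rewrite cardE -(size_map val); apply: uniq_leq_size.
  by rewrite (map_inj_uniq val_inj) enum_uniq.
by move=> x /mapP[v]; rewrite mem_enum => Zv ->; apply: sub.
Qed.

Definition window {A : Type} (u : nat -> A) (i n : nat) : seq A :=
  mkseq (fun k => u (i + k)%N) n.

Lemma take_window {A : Type} (u : nat -> A) i n :
  take n (window u i n.+1) = window u i n.
Proof. by rewrite /window /mkseq -map_take take_iota (minn_idPl (leqnSn n)). Qed.

Lemma drop_window {A : Type} (u : nat -> A) i n :
  drop 1 (window u i n.+1) = window u i.+1 n.
Proof.
rewrite /window /mkseq -map_drop /= drop0 (iotaDl 1 0) -map_comp.
by apply: eq_map => k /=; rewrite add1n addSnnS.
Qed.

Lemma factor_window {A : Type} (u : nat -> A) i n : factor u (window u i n).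
Proof. by exists i; rewrite size_mkseq. Qed.

(** * Orbits of words and their first occurrences *)

Section TwoAntimorphisms.

Context {A : finType} {Theta1 Theta2 : seq A -> seq A}.
Context (anti1 : antimorphism Theta1) (anti2 : antimorphism Theta2).
Context (inv1 : involutive Theta1) (inv2 : involutive Theta2).
Context (commuting : forall w, Theta1 (Theta2 w) = Theta2 (Theta1 w)).
Context (u : nat -> A).
Context (closed1 : closed_under u Theta1) (closed2 : closed_under u Theta2).

Let size1 := size_antimorphism anti1 inv1.
Let size2 := size_antimorphism anti2 inv2.

(** Entries may repeat, so orbits are compared by membership only. *)
Definition sym_orbit (w : seq A) : seq (seq A) :=
  [:: w; Theta1 w; Theta2 w; Theta1 (Theta2 w)].

Definition is_pal (w : seq A) : bool := (Theta1 w == w) || (Theta2 w == w).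

Lemma sym_orbit1 w : sym_orbit (Theta1 w) =i sym_orbit w.
Proof.
move=> x; rewrite !inE inv1 -commuting !inv1.
by do 4!case: (x == _).
Qed.

Lemma sym_orbit2 w : sym_orbit (Theta2 w) =i sym_orbit w.
Proof.
move=> x; rewrite !inE !inv2.
by do 4!case: (x == _).
Qed.

Lemma sym_orbit_eq v w : v \in sym_orbit w -> sym_orbit v =i sym_orbit w.
Proof.
rewrite !inE => /or4P[] /eqP-> x //.
- exact: sym_orbit1.
- exact: sym_orbit2.
- by rewrite sym_orbit1 sym_orbit2.
Qed.

Lemma sym_orbit_sym v w : v \in sym_orbit w -> w \in sym_orbit v.
Proof. by move/sym_orbit_eq->; rewrite mem_head. Qed.

(** A nontrivial stabiliser halves the orbit; this offsets the extra weight of palindromes in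
    [sum_root_vertices]. *)
Lemma sym_orbit_pal w : is_pal w ->
  {subset sym_orbit w <= [:: Theta1 (Theta2 w); w]}.
Proof.
move=> pal x; rewrite !inE; case/orP: pal => /eqP E.
  by rewrite commuting E; do 2!case: (x == _).
by rewrite E; do 2!case: (x == _).
Qed.

Lemma size_sym_orbit v w : v \in sym_orbit w -> size v = size w.
Proof. by rewrite !inE => /or4P[] /eqP->; rewrite ?size1 ?size2. Qed.

Definition occurs_at (w : seq A) (i : nat) : bool :=
  window u i (size w) \in sym_orbit w.

(* Junk value 0 when no element of the orbit of [w] is a factor. *)
Definition first_occ (w : seq A) : nat :=
  if pselect (exists i, occurs_at w i) is left ex then ex_minn ex else 0%N.

Lemma first_occ_at w i : occurs_at w i -> occurs_at w (first_occ w).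
Proof.
rewrite /first_occ; case: pselect => [ex _|nex occ]; first by case: ex_minnP.
by case: nex; exists i.
Qed.

Lemma first_occ_min w i : occurs_at w i -> (first_occ w <= i)%N.
Proof.
rewrite /first_occ; case: pselect => [ex|nex occ].
  by case: ex_minnP => m _; apply.
by case: nex; exists i.
Qed.

Lemma factor_occurs w : factor u w -> exists i, occurs_at w i.
Proof. by case=> i E; exists i; rewrite /occurs_at /window -E mem_head. Qed.

Lemma first_occ_orbit v w :
  v \in sym_orbit w -> first_occ v = first_occ w.
Proof.
move=> vw.
have E : occurs_at v = occurs_at w.
  by apply: funext => i; rewrite /occurs_at (size_sym_orbit _ _ vw) (sym_orbit_eq _ _ vw).
by rewrite /first_occ E.
Qed.

Lemma first_occ1 w : first_occ (Theta1 w) = first_occ w.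
Proof. by apply: first_occ_orbit; rewrite !inE eqxx orbT. Qed.

Lemma first_occ2 w : first_occ (Theta2 w) = first_occ w.
Proof. by apply: first_occ_orbit; rewrite !inE eqxx !orbT. Qed.

(** * Steep edges and weighted counting of vertices *)

Section Edges.

Context (n : nat).

Definition steep (e : seq A) : bool :=
  first_occ (take n e) != first_occ (drop 1 e).

(** The choice made for a tie is arbitrary and does not commute with the antimorphisms, hence the
    steepness assumption in [upper_end1] and [upper_end2]. *)
Definition upper_end (e : seq A) : seq A :=
  if (first_occ (take n e) < first_occ (drop 1 e))%N then drop 1 e else take n e.

Lemma steep1 e : size e = n.+1 -> steep (Theta1 e) = steep e.
Proof.
move=> se; rewrite /steep (take_antimorphism anti1 inv1) //.
by rewrite (drop_antimorphism anti1 inv1 _ _ se) !first_occ1 eq_sym.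
Qed.

Lemma steep2 e : size e = n.+1 -> steep (Theta2 e) = steep e.
Proof.
move=> se; rewrite /steep (take_antimorphism anti2 inv2) //.
by rewrite (drop_antimorphism anti2 inv2 _ _ se) !first_occ2 eq_sym.
Qed.

Lemma upper_end1 e : size e = n.+1 -> steep e ->
  upper_end (Theta1 e) = Theta1 (upper_end e).
Proof.
move=> se; rewrite /steep /upper_end (take_antimorphism anti1 inv1) //.
rewrite (drop_antimorphism anti1 inv1 _ _ se) !first_occ1.
by case: ltngtP.
Qed.

Lemma upper_end2 e : size e = n.+1 -> steep e ->
  upper_end (Theta2 e) = Theta2 (upper_end e).
Proof.
move=> se; rewrite /steep /upper_end (take_antimorphism anti2 inv2) //.
rewrite (drop_antimorphism anti2 inv2 _ _ se) !first_occ2.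
by case: ltngtP.
Qed.

Lemma steep_not_pal e : size e = n.+1 -> steep e -> ~~ is_pal e.
Proof.
move=> se; apply: contraL => /orP[] /eqP E; rewrite /steep negbK.
  by rewrite -{1}E (take_antimorphism anti1 inv1) // first_occ1.
by rewrite -{1}E (take_antimorphism anti2 inv2) // first_occ2.
Qed.

Lemma upper_end_surj v : factor u v -> size v = n -> (0 < first_occ v)%N ->
  exists e, [/\ factor u e, size e = n.+1, steep e & upper_end e = v].
Proof.
move=> fv sv; have [j /first_occ_at] := factor_occurs v fv.
case Ei: (first_occ v) => [//|i]; rewrite /occurs_at sv => occ _.
(* The first occurrence is [i.+1], so the left end of [w], which occurs at [i], has a strictly
   smaller one. *)
set w := window u i n.+1.
have fw : factor u w by apply: factor_window.
have sw : size w = n.+1 by rewrite size_mkseq.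
have dw : first_occ (drop 1 w) = i.+1 by rewrite drop_window (first_occ_orbit _ _ occ).
have tw : (first_occ (take n w) < first_occ (drop 1 w))%N.
  rewrite dw ltnS take_window; apply: first_occ_min.
  by rewrite /occurs_at size_mkseq mem_head.
have stw : steep w by rewrite /steep neq_ltn tw.
have upw : upper_end w = window u i.+1 n by rewrite /upper_end tw drop_window.
(* The upper end of [w] is only known to lie in the orbit of [v]; the group element carrying it to
   [v] is applied to the edge [w]. *)
move: occ; rewrite -upw !inE => /or4P[] /eqP E.
- by exists w.
- exists (Theta1 w); split; first exact: closed1.
  + by rewrite size1.
  + by rewrite steep1.
  + by rewrite upper_end1 // E inv1.
- exists (Theta2 w); split; first exact: closed2.
  + by rewrite size2.
  + by rewrite steep2.
  + by rewrite upper_end2 // E inv2.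
- exists (Theta1 (Theta2 w)); split; first by apply/closed1/closed2.
  + by rewrite size1 size2.
  + by rewrite steep1 ?steep2 ?size2.
  + by rewrite upper_end1 ?upper_end2 ?steep2 ?size2 // E -commuting inv2 inv1.
Qed.

Definition steep_edges : {set n.+1.-tuple A} :=
  [set e in factors u n.+1 | steep e].

(** The weight [1 + is_pal v] counts [v] once as a vertex and once more if it is palindromic. *)
Lemma fibre_upper_end (v : n.-tuple A) :
  v \in factors u n -> (0 < first_occ v)%N ->
  (1 + is_pal v <= #|[set e in steep_edges | upper_end e == v]|)%N.
Proof.
rewrite inE => /asboolP fv v_gt0.
have [e [fe /eqP se ste upe]] := upper_end_surj v fv (size_tuple v) v_gt0.
set F := [set _ in _ | _].
have inF (e' : n.+1.-tuple A) :
    factor u e' -> steep e' -> upper_end e' = v -> e' \in F.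
  by move=> fe' ste' upe'; rewrite !inE ste' upe' eqxx !andbT; apply/asboolP.
have Fe : Tuple se \in F by apply: inF.
have := steep_not_pal e (eqP se) ste; rewrite negb_or => /andP[ne1 ne2].
have two (T : seq A -> seq A) (sT : size (T e) == n.+1) :
    T e != e -> factor u (T e) -> steep (T e) -> upper_end (T e) = v ->
    (2 <= #|F|)%N.
  move=> neq fTe stTe upTe.
  have <- : #|[set Tuple se; Tuple sT]| = 2%N.
    by rewrite cards2 -val_eqE /= eq_sym neq.
  by apply: subset_leq_card; apply/subsetP => x /set2P[] ->; last exact: inF.
case: (boolP (is_pal v)) => [/orP[]/eqP E|_].
- apply: (two Theta1) => //; rewrite ?size1 //; first exact: closed1.
  + by rewrite steep1 //; apply/eqP.
  + by rewrite upper_end1 ?upe //; apply/eqP.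
- apply: (two Theta2) => //; rewrite ?size2 //; first exact: closed2.
  + by rewrite steep2 //; apply/eqP.
  + by rewrite upper_end2 ?upe //; apply/eqP.
- by rewrite addn0 card_gt0; apply/set0Pn; exists (Tuple se).
Qed.

(** Double counting of pairs of a steep edge and its upper end: each vertex receives at least its
    weight, and each edge has a single upper end. *)
Lemma sum_upper_vertices :
  (\sum_(v in factors u n | 0 < first_occ v) (1 + is_pal v) <= #|steep_edges|)%N.
Proof.
apply: (@leq_trans (\sum_(v in factors u n | 0 < first_occ v)
                     \sum_(e in steep_edges) (upper_end e == v))%N).
  apply: leq_sum => v /andP[fv v_gt0].
  apply: leq_trans (fibre_upper_end v fv v_gt0) _.
  rewrite -sum1_card big_mkcond /= [leqRHS]big_mkcond /= leq_sum // => e _.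
  by rewrite in_set; case: (e \in steep_edges) => //=; case: (_ == _).
rewrite exchange_big /= -sum1_card leq_sum // => e _.
rewrite big_mkcond /=.
apply: (@leq_trans (\sum_(v : n.-tuple A) (upper_end e == v))%N).
  by apply: leq_sum => v _; case: ifP.
rewrite -big_mkcond /= sum1_card -cardsE.
apply: (card_set_tuple_le _ [:: upper_end e]) => v.
by rewrite !inE => /eqP->.
Qed.

Lemma sum_root_vertices :
  (\sum_(v in factors u n | first_occ v == 0) (1 + is_pal v) <= 4)%N.
Proof.
set Z := [set v in factors u n | first_occ v == 0%N].
have -> : (\sum_(v in factors u n | first_occ v == 0) (1 + is_pal v) =
           #|Z| + #|[set v in Z | is_pal v]|)%N.
  rewrite big_split /= -!sum1_card; congr addn.
    by apply: eq_bigl => v; rewrite !inE.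
  by rewrite -big_mkcondr; apply: eq_bigl => v; rewrite !inE.
(* Since [v] is a factor, the value 0 is a genuine first occurrence and not the junk one. *)
have Zorb (v : n.-tuple A) : v \in Z -> tval v \in sym_orbit (window u 0 n).
  rewrite inE => /andP[]; rewrite inE => /asboolP /factor_occurs[i /first_occ_at].
  move=> occ /eqP v0.
  apply: sym_orbit_sym; move: occ.
  by rewrite v0 /occurs_at size_tuple.
(* Without palindromes the bound is 4 + 0; with one, the orbit has at most two elements and the
   bound is 2 + 2. *)
case: (set_0Vmem [set v in Z | is_pal v]) => [->|[v0]].
  by rewrite cards0 addn0; exact: (card_set_tuple_le _ _ Zorb).
rewrite inE => /andP[Zv0 pal0].
have le2 : (#|Z| <= 2)%N.
  apply: (card_set_tuple_le _ [:: Theta1 (Theta2 v0); tval v0]) => v Zv.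
  apply: sym_orbit_pal => //.
  by rewrite (sym_orbit_eq _ _ (Zorb _ Zv0)) Zorb.
rewrite (leq_add le2) //; apply: leq_trans le2.
by apply: subset_leq_card; apply/subsetP => v; rewrite inE => /andP[].
Qed.

Lemma vertices_edges_bound :
  (#|factors u n| + #|[set v in factors u n | is_pal v]|
   + #|[set e in factors u n.+1 | is_pal e]| <= #|factors u n.+1| + 4)%N.
Proof.
have -> : (#|factors u n| + #|[set v in factors u n | is_pal v]| =
           \sum_(v in factors u n) (1 + is_pal v))%N.
  rewrite big_split /= -!sum1_card; congr addn.
  by rewrite -big_mkcondr; apply: eq_bigl => v; rewrite inE.
rewrite (bigID (fun v : n.-tuple A => 0 < first_occ v)%N) /=.
have E : (\sum_(v in factors u n | ~~ (0 < first_occ v)) (1 + is_pal v) <= 4)%N.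
  apply: leq_trans sum_root_vertices; rewrite leq_eqVlt; apply/orP; left.
  by apply/eqP/eq_bigl => v; rewrite -eqn0Ngt.
(* Steep and palindromic edges are disjoint sets of edges. *)
have le_edges : (#|steep_edges| + #|[set e in factors u n.+1 | is_pal e]|
        <= #|factors u n.+1|)%N.
  rewrite -cardsUI [X in (_ + X)%N](_ : _ = 0%N).
    rewrite addn0; apply/subset_leq_card/subsetP => e.
    by rewrite !inE => /orP[] /andP[].
  apply/eqP; rewrite cards_eq0 -subset0; apply/subsetP => e; rewrite !inE.
  case/andP=> /andP[_ ste] /andP[_].
  by rewrite (negPf (steep_not_pal _ (size_tuple e) ste)).
apply: leq_trans (leq_add (leq_add sum_upper_vertices E) (leqnn _)) _.
by rewrite addnAC leq_add2r.
Qed.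

End Edges.

(** Inclusion-exclusion for the words fixed by [Theta1] and those fixed by [Theta2]. *)
Lemma pal_complexity_union k :
  (pal_complexity u Theta1 k + pal_complexity u Theta2 k =
   #|[set w in factors u k | is_pal w]| + pal_complexity2 u Theta1 Theta2 k)%N.
Proof.
rewrite /pal_complexity /pal_complexity2 -cardsUI; congr addn; apply: eq_card => w.
  by rewrite !inE /is_pal andb_orr.
rewrite !inE [tval w == _]eq_sym.
case: (boolP (_ && (Theta1 w == w))) => [/andP[-> /eqP E]|].
  by rewrite E eqxx /= eq_sym.
by case: (asbool _) => //= /negPf->.
Qed.

End TwoAntimorphisms.

Theorem theorem3 (A : finType) (Theta1 Theta2 : seq A -> seq A)
    (anti1 : antimorphism Theta1) (anti2 : antimorphism Theta2)
    (inv1 : involutive Theta1) (inv2 : involutive Theta2)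
    (distinct : ~ (Theta1 =1 Theta2))
    (commuting : forall w : seq A, Theta1 (Theta2 w) = Theta2 (Theta1 w))
    (u : nat -> A) (all_letters : forall a : A, exists i : nat, u i = a)
    (closed1 : closed_under u Theta1) (closed2 : closed_under u Theta2)
    (n : nat) (n_ge1 : (1 <= n)%N) :
  Dcomplexity u n + 4 >=
    (pal_complexity u Theta1 n)%:Z + (pal_complexity u Theta2 n)%:Z
      - (pal_complexity2 u Theta1 Theta2 n)%:Z
    + (pal_complexity u Theta1 n.+1)%:Z + (pal_complexity u Theta2 n.+1)%:Z
      - (pal_complexity2 u Theta1 Theta2 n.+1)%:Z.

Proof.
(* By inclusion-exclusion at [n] and [n.+1], the left side of this bound turns into the palindromic
   terms plus the complexity at [n]. *)
have := vertices_edges_bound anti1 anti2 inv1 inv2 commuting u closed1 closed2 n.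
have := pal_complexity_union (Theta1 := Theta1) (Theta2 := Theta2) u n.
have := pal_complexity_union (Theta1 := Theta1) (Theta2 := Theta2) u n.+1.
rewrite /Dcomplexity /complexity.
by lia.
Qed.
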